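(* Suppose $G$ is a non-compact, Roelcke precompact Polish group. Then there is a neighbourhood basis at $1$, $V_0\supseteq V_1\supseteq \ldots \ni 1$, such that for any $h_n\in G$ and finite $F_n\subseteq G$ ($n\in\mathbb N$), $$G\neq \bigcup_n F_nV_nh_n.$$
   Context: A Polish group is a separable, completely metrisable topological group. A topological group $G$ is Roelcke precompact if for any open $V\ni 1$ there is a finite set $F\subseteq G$ such that $G=VFV$. *)

(* Defs.v *)
From HB Require Import structures.
From mathcomp Require Import all_boot all_order all_algebra.
From mathcomp Require Import all_classical all_reals all_analysis.

Set Implicit Arguments.
Unset Strict Implicit.
Unset Printing Implicit Defensive.

Import Order.TTheory GRing.Theory Num.Theory.

Local Open Scope classical_set_scope.
Local Open Scope ring_scope.
Local Open Scope group_scope.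

HB.structure Definition PreTopologicalGroup :=
  {G of Topological G & Group G}.

HB.mixin Record PreTopologicalGroup_isTopologicalGroup G
    & PreTopologicalGroup G := {
  mulg_continuous : continuous (fun x : G * G => x.1 * x.2) ;
  invg_continuous : continuous (fun x : G => x^-1)
}.

#[short(type="topologicalGroupType")]
HB.structure Definition TopologicalGroup :=
  {G of PreTopologicalGroup G & PreTopologicalGroup_isTopologicalGroup G}.

Definition separable_space (T : topologicalType) :=
  exists2 D : set T, countable D & dense D.

Definition is_metric (R : realType) (T : Type) (d : T -> T -> R) :=
  [/\ forall x, d x x = 0%R,
      forall x y, d x y = 0%R -> x = y,
      forall x y, d x y = d y x
    & forall x y z, d x z <= d x y + d y z]%R.

Definition metrizes (R : realType) (T : topologicalType) (d : T -> T -> R) :=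
  forall (x : T) (A : set T),
    nbhs x A <-> exists2 e : R, (0 < e)%R & [set y | d x y < e]%R `<=` A.

(* [u @ \oo --> x] refers to the topology of [T]; it is used only for [d] with
   [metrizes d], where it is convergence with respect to [d]. *)
Definition complete_metric (R : realType) (T : topologicalType)
    (d : T -> T -> R) :=
  forall u : nat -> T,
    (forall e : R, (0 < e)%R ->
      exists N, forall m n, (N <= m)%N -> (N <= n)%N -> (d (u m) (u n) < e)%R) ->
    exists x : T, u @ \oo --> x.

Definition completely_metrizable (R : realType) (T : topologicalType) :=
  exists d : T -> T -> R, [/\ is_metric d, metrizes d & complete_metric d].

Definition polish (R : realType) (T : topologicalType) :=
  separable_space T /\ completely_metrizable R T.

Definition set_mulg (G : groupType) (A B : set G) : set G :=
  [set a * b | a in A & b in B].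

Definition roelcke_precompact (G : topologicalGroupType) :=
  forall V : set G, open V -> V 1 ->
    exists2 F : set G, finite_set F & [set: G] = set_mulg (set_mulg V F) V.

Definition nbhs_basis (T : topologicalType) (x : T) (V : nat -> set T) :=
  (forall n, nbhs x (V n)) /\
  (forall U : set T, nbhs x U -> exists n, V n `<=` U).

(* Main.v *)
Require Import Defs.
From mathcomp Require Import all_boot all_order all_algebra.
From mathcomp Require Import all_classical all_reals all_analysis.

Local Open Scope classical_set_scope.
Local Open Scope group_scope.

Import Order.TTheory GRing.Theory Num.Theory.

(** Why the theorem holds.  The model case is the automorphism group of an
    omega-categorical structure.  There one takes for [V_n] the pointwise
    stabiliser of a tuple [a_n]; the set [F V_n h] consists of the
    automorphisms that send the tuple [h^-1 a_n] into a given finite set.  An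
    automorphism outside all of these sets is built by finite approximation:
    at stage [n] the images of a finite tuple [c] are fixed already, and the
    image of [h^-1 a_n] can still be chosen freely provided that this tuple is
    not algebraic over [c].  The number of types of the tuples [c] that can
    occur at stage [n] is finite, so the size of their algebraic closures is
    bounded in advance, and it is enough that [a_n] be longer than this bound.

    The proof below is the same argument in an arbitrary Roelcke precompact
    group, with neighbourhoods of [1] in the role of stabilisers.

    - A non-compact Polish group has a neighbourhood [U] of [1] such that [G]
      is not a finite union of left translates of [U]
      ([compact_of_precompact]).
    - The algebraic closure of [W] at scale [V] is the set of the [x] such that
      [W x] is covered by finitely many left translates of [V].  By Roelcke
      precompactness it is itself covered by finitely many left translates of
      [U] ([roelcke_small_orbits]).  Hence every [W] has a [V] such that [W] is
      contained in no [F V h] with [F] finite ([nbhs_not_finitely_covered]):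
      with [k = h^-1] and [V] small with respect to many [U]-separated points
      [g_i], it would follow from [W k] contained in [F V] that all the [k g_i]
      are algebraic over [W].
    - The finiteness of the number of types becomes: an intersection of
      conjugates [k W k^-1] and [h V h^-1], with arbitrary [k] and [h],
      contains a conjugate of one fixed neighbourhood ([roelcke_conj2]).

    These facts give neighbourhoods [W_0, V_0, W_1, V_1, ...], chosen before the
    [h_n] and [F_n] are known ([escape_step]).  Given the [h_n] and [F_n], one
    finds a decreasing sequence of sets [x_n k_n W_n k_n^-1], the [(n+1)]-st
    of which stays away from [F_n V_n h_n].  The conjugating elements [k_n] are
    not under control, so that the sets cannot be made small for a complete
    metric; but they can be made small on both sides of [x_n] in the sense of
    the group, and that is enough, because a Polish group is complete for its
    two-sided uniformity ([bicauchy_cvg]).  The limit of the [x_n] is the point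
    sought ([escaping_point]). *)

(** * Choice, filters and metrizable spaces *)

(** The invariant [P] and the step [Q] depend on the stage, since the
    constructions below approximate ever more closely. *)
Lemma indexed_dependent_choice {X : Type} (P : nat -> X -> Prop)
    (Q : nat -> X -> X -> Prop) (x0 : X) :
  P 0%N x0 ->
  (forall n x, P n x -> exists y, P n.+1 y /\ Q n x y) ->
  exists f : nat -> X, forall n, P n (f n) /\ Q n (f n) (f n.+1).
Proof.
move=> Px0 step.
have /choice[g gP] : forall nx : nat * X, exists y,
    P nx.1 nx.2 -> P nx.1.+1 y /\ Q nx.1 nx.2 y.
  move=> [n x] /=.
  have [/step[y Py]|nPx] := pselect (P n x); first by exists y.
  by exists x.
pose f := fix f n := if n is m.+1 then g (m, f m) else x0.
have Pf n : P n (f n) by elim: n => //= n /(gP (n, f n))[].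
by exists f => n; split => //; have [] := gP (n, f n) (Pf n).
Qed.

Lemma filter_finite_bigcap {T : Type} {I : choiceType} (F : set_system T)
    {FF : Filter F} (D : set I) (A : I -> set T) :
  finite_set D -> (forall i, D i -> F (A i)) -> F (\bigcap_(i in D) A i).
Proof. by move=> /finite_fsetP[E ->] FA; apply: filter_bigI => i /FA. Qed.

Lemma ultra_finite_cover {T I : choiceType} (F : set_system T) (D : set I)
    (A : I -> set T) : UltraFilter F -> finite_set D -> F (\bigcup_(i in D) A i) ->
  exists2 i, D i & F (A i).
Proof.
move=> UF /finite_seqP[s ->]; elim: s => [|i s IH] FA.
  by move: FA; rewrite set_nil bigcup_set0 => /filter_ex[].
have [FAi|FAi] := in_ultra_setVsetC (A i) UF.
  by exists i => //=; rewrite mem_head.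
have [|j js Aj] := IH.
  apply: filterS (filterI FA FAi) => t [[j /=]].
  rewrite inE => /orP[/eqP->//|js] At _; by exists j.
by exists j => //=; rewrite inE js orbT.
Qed.

Lemma metrizable_nbhs_basis {R : realType} {T : topologicalType} (p : T) :
  completely_metrizable R T ->
  exists B : nat -> set T, nbhs_basis p B.
Proof.
move=> [d [_ dtop _]].
exists (fun n => [set y | (d p y < n.+1%:R^-1)%R]); split.
- by move=> n; apply/dtop; exists (n.+1%:R^-1)%R => //; rewrite invr_gt0.
- move=> U /dtop[e e0 eU]; have [k] := ltr_add_invr e0; rewrite add0r => ke.
  by exists k => y /= pyk; apply: eU => /=; exact: lt_trans ke.
Qed.

(** * Neighbourhoods in topological groups *)

Section topological_group.
Context {G : topologicalGroupType}.
Implicit Types (x y z : G) (U V W : set G).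

Lemma nbhs_mulgl {x y U} : nbhs (x * y) U -> nbhs y [set z | U (x * z)].
Proof.
move=> xyU.
have : (x * z @[z --> y] --> x * y)%classic.
  apply: (cvg_comp2 (G := nbhs x) (H := nbhs y) (h := fun a b => a * b)).
  - exact: cvg_cst.
  - exact: cvg_id.
  - exact: (mulg_continuous (x, y)).
exact.
Qed.

Lemma nbhs_mulgr {x y U} : nbhs (x * y) U -> nbhs x [set z | U (z * y)].
Proof.
move=> xyU.
have : (z * y @[z --> x] --> x * y)%classic.
  apply: (cvg_comp2 (G := nbhs x) (H := nbhs y) (h := fun a b => a * b)).
  - exact: cvg_id.
  - exact: cvg_cst.
  - exact: (mulg_continuous (x, y)).
exact.
Qed.

Lemma nbhs_translate {x U} : nbhs x U -> nbhs 1 [set s | U (x * s)].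
Proof. by move=> xU; apply: nbhs_mulgl; rewrite mulg1. Qed.

Lemma nbhs_conjg x {U} : nbhs 1 U -> nbhs 1 [set s | U (s ^ x)].
Proof.
move=> U1; apply: (nbhs_mulgr (x := 1) (U := [set s | U (x^-1 * s)])).
by apply: nbhs_mulgl; rewrite mul1g mulVg.
Qed.

(** Three factors instead of two: they suffice for every product below, where
    [1] is used to fill up. *)
Lemma nbhs1_root {U} : nbhs 1 U ->
  exists V, [/\ open V, V 1, forall x, V x -> V x^-1
    & forall x y z, V x -> V y -> V z -> U (x * y * z)].
Proof.
have half A : nbhs 1 A ->
    exists2 B, nbhs 1 B & forall x y : G, B x -> B y -> A (x * y).
  move=> A1; have A11 : nbhs (1 * 1) A by rewrite mulg1.
  have [[B C] /= [B1 C1] BCA] := @mulg_continuous G (1, 1) A A11.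
  exists (B `&` C); first exact: filterI.
  by move=> x y [Bx _] [_ Cy]; apply: (BCA (x, y)).
move=> /half[A A1 AU]; have [B B1 BA] := half A A1.
have BI1 : nbhs 1 [set x : G | B x^-1].
  by apply: (@invg_continuous G 1); rewrite invg1.
pose C := A `&` B.
pose V := C° `&` [set x | C° x^-1].
have C1 : nbhs 1 C by exact: filterI.
have C1' := nbhs_singleton (nbhs_interior C1).
exists V; split.
- apply: openI; first exact: open_interior.
  apply: (proj1 (continuousP _) (@invg_continuous G)); exact: open_interior.
- by split; rewrite //= invg1.
- by move=> x [xC x'C]; split; rewrite //= invgK.
- move=> x y z [/interior_subset[_ Bx] _] [/interior_subset[_ By] _].
  by move=> [/interior_subset[Az _] _]; apply: (AU) => //; apply: BA.
Qed.

End topological_group.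

(** * Completeness of the two-sided uniformity *)

Section completeness.
Context {G : topologicalGroupType}.

(** Cauchy sequences of the two-sided uniformity, the join of the left and the
    right one. *)
Definition bicauchy (x : nat -> G) := forall U : set G, nbhs 1 U ->
  exists N, forall m n, (N <= m)%N -> (N <= n)%N ->
    U ((x n)^-1 * x m) /\ U (x m * (x n)^-1).

Lemma bicauchy_cvg_subseq {x : nat -> G} {phi : nat -> nat} {p : G} :
  bicauchy x -> (forall k, (k <= phi k)%N) -> x \o phi @ \oo --> p ->
  x @ \oo --> p.
Proof.
move=> xC phik xphip U /nbhs_translate/nbhs1_root[V [oV V1 _ VU]].
have V1n : nbhs 1 V by exact: open_nbhs_nbhs.
have [N NV] := xC V V1n.
have pV : nbhs p [set z | V (p^-1 * z)].
  by apply: nbhs_mulgl; rewrite mulVg; exact: open_nbhs_nbhs.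
have [K _ KV] := xphip _ pV.
exists N => // m /= Nm.
pose k := maxn K N.
have Vk : V (p^-1 * x (phi k)) by apply: KV; rewrite /= leq_maxl.
have Nk : (N <= phi k)%N by apply: leq_trans (phik k); exact: leq_maxr.
have [Vkm _] := NV m (phi k) Nm Nk.
have := VU _ _ _ Vk Vkm V1.
by rewrite /= mulg1 -mulgA mulVKg mulVKg.
Qed.

Lemma nested_cvg {R : realType} {d : G -> G -> R} {u : nat -> G}
    {A : nat -> set G} :
  complete_metric d -> (forall k, A k.+1 `<=` A k) -> (forall k, A k (u k)) ->
  (forall k a b, A k.+1 a -> A k.+1 b -> (d a b < k.+1%:R^-1)%R) ->
  exists p : G, u @ \oo --> p.
Proof.
move=> dcomplete Adec Au Adiam; apply: dcomplete => e e0.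
have [k] := ltr_add_invr e0; rewrite add0r => ke.
have Amono i j : (i <= j)%N -> A j `<=` A i.
  move=> /subnK <-; elim: (j - i)%N => // l IH.
  by rewrite addSn => a /Adec/IH.
exists k.+1 => m n km kn; apply: lt_trans ke.
by apply: Adiam; [exact: (Amono _ m)|exact: (Amono _ n)].
Qed.

(** A topologically complete group is complete for its two-sided uniformity.
    In the completion [H] of [G] for that uniformity, [G] is a dense G-delta
    set; if [x] in [H] is the limit of the sequence, then [x G] and [G] meet by
    Baire's theorem, so that [x] is in [G].  The proof unfolds this without
    constructing [H]: it produces [y_k] and [x_(N_k) y_k], both Cauchy for a
    complete metric of [G], with limits [y] and [z], and then [x] converges to
    [z y^-1].  One step takes [z_k = x_(N_k) y_k], sets [y' = x_(N')^-1 z_k] for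
    a large [N'], which keeps [x_(N') y' = z_k], and then increases the index
    again to [N''] with [y'] unchanged.  Then [y'] is near [y_k] and
    [x_(N'') y'] is near [z_k], in neighbourhoods that were fixed before [N']
    and [N''] were chosen. *)
Lemma bicauchy_cvg {R : realType} {x : nat -> G} :
  completely_metrizable R G -> bicauchy x -> exists p : G, x @ \oo --> p.
Proof.
move=> [d [[dxx _ dsym dtri] dtop dcomplete]] xC.
have small (e : R) (p : G) (A : set G) : (0 < e)%R -> nbhs p A ->
    exists B, [/\ nbhs p B, B `<=` A & forall a b, B a -> B b -> (d a b < e)%R].
  move=> e0 pA; exists (A `&` [set y | (d p y < e / 2)%R]); split.
  - by apply: filterI => //; apply/dtop; exists (e / 2)%R => //; rewrite divr_gt0.
  - by move=> ? [].
  - move=> a b [_ /= pa] [_ /= pb]; apply: le_lt_trans (dtri a p b) _.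
    by rewrite (splitr e) dsym ltrD.
(* In a state [(y, N, A, B)], the later points [y'] remain in [A], and the later
   [x_(N') y'] remain in [B]. *)
pose P k (s : G * nat * set G * set G) := let: (y, N, A, B) := s in
  [/\ (k <= N)%N, nbhs (x N * y) B
    & forall m, (N <= m)%N -> nbhs ((x m)^-1 * x N * y) A].
pose small_set k (A : set G) := forall a b, A a -> A b -> (d a b < k.+1%:R^-1)%R.
pose Q k (s s' : G * nat * set G * set G) :=
  let: (_, _, A, B) := s in let: (_, _, A', B') := s' in
  [/\ A' `<=` A, B' `<=` B, small_set k A' & small_set k B'].
have [||f fPQ] := @indexed_dependent_choice _ P Q (1, 0%N, setT, setT).
- by split => // *; exact: filterT.
- move=> k [[[y N] A] B] [kN zB yA].
  have e0 : (0 < k.+1%:R^-1 :> R)%R by rewrite invr_gt0.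
  have [S [zS SB Sk]] := small _ _ _ e0 zB.
  have [N1 N1S] := xC _ (nbhs_mulgr (x := 1) (y := x N * y)
    (eq_ind_r (nbhs ^~ S°) (nbhs_interior zS) (mul1g _))).
  pose N' := maxn (maxn N N1) k.+1.
  have NN' : (N <= N')%N by rewrite /N' !leq_max leqnn.
  have N1N' : (N1 <= N')%N by rewrite /N' !leq_max leqnn orbT.
  have kN' : (k < N')%N by rewrite /N' leq_max leqnn orbT.
  pose y' := (x N')^-1 * (x N * y).
  have y'A : nbhs y' A by rewrite /y' mulgA; exact: yA.
  have [A' [y'A' A'A A'k]] := small _ _ _ e0 y'A.
  have [N2 N2A] := xC _ (nbhs_mulgr (x := 1) (y := y')
    (eq_ind_r (nbhs ^~ A'°) (nbhs_interior y'A') (mul1g _))).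
  pose N'' := maxn N' N2.
  have N'N'' : (N' <= N'')%N by rewrite /N'' leq_maxl.
  exists (y', N'', A', S); split; last by [].
  split; first exact: leq_trans N'N''.
  - have [_] := N1S N'' N' (leq_trans N1N' N'N'') N1N'.
    by rewrite /= -mulgA.
  - move=> m N''m.
    have N2m : (N2 <= m)%N by apply: leq_trans N''m; exact: leq_maxr.
    by have [] := N2A N'' m (leq_maxr _ _) N2m.
pose y k := (f k).1.1.1; pose N k := (f k).1.1.2.
have [p yp] : exists p : G, y @ \oo --> p.
  apply: (@nested_cvg _ d _ (fun k => (f k).1.2)) => // k;
    have := fPQ k; rewrite /y; case: (f k) => [[[yk Nk] A] B];
    case: (f k.+1) => [[[yk' Nk'] A'] B'] [[_ _ yA] []] //= _ _ _ _.
  by have := nbhs_singleton (yA _ (leqnn _)); rewrite mulVg mul1g.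
have [q zq] : exists q : G, (fun k => x (N k) * y k) @ \oo --> q.
  apply: (@nested_cvg _ d _ (fun k => (f k).2)) => // k;
    have := fPQ k; rewrite /y /N; case: (f k) => [[[yk Nk] A] B];
    case: (f k.+1) => [[[yk' Nk'] A'] B'] [[_ zB _] []] //= _ _ _ _.
  exact: nbhs_singleton zB.
exists (q * p^-1); apply: (bicauchy_cvg_subseq (phi := N)) => //.
  by move=> k; have [+ _] := fPQ k; rewrite /N; case: (f k) => [[[? ?] ?] ?] [].
have -> : x \o N = fun k => x (N k) * y k * (y k)^-1.
  by apply/funext => k /=; rewrite mulgK.
have yVp : (fun k => (y k)^-1) @ \oo --> p^-1.
  exact: cvg_comp yp (@invg_continuous G p).
exact: cvg_comp2 zq yVp (@mulg_continuous G (q, p^-1)).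
Qed.

End completeness.

(** * Non-compact groups are not precompact *)

(** Applying the hypothesis to [U] and, after inversion, to [U^-1] shows that an
    ultrafilter contains sets which are small for the left and for the right
    uniformity, so it converges by completeness for the two-sided one. *)
Lemma compact_of_precompact {R : realType} {G : topologicalGroupType} :
  completely_metrizable R G ->
  (forall U : set G, nbhs 1 U ->
    exists2 F : set G, finite_set F & [set: G] `<=` set_mulg F U) ->
  compact [set: G].
Proof.
move=> Gcm Gpc; rewrite compact_ultra => F UF _.
have [B [B1 Bbasis]] := metrizable_nbhs_basis (1 : G) Gcm.
have left_small U : nbhs 1 U -> exists2 a : G, True & F [set x | U (a^-1 * x)].
  move=> /Gpc[D Dfin DU].
  have [|a _ Fa] :=
      ultra_finite_cover F D (fun a => [set x | U (a^-1 * x)]) UF Dfin;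
    last by exists a.
    apply: filterS filterT => x /DU[a Da [u Uu ux]].
    by exists a => //=; rewrite -ux mulKg.
have right_small U : nbhs 1 U -> exists2 a : G, True & F [set x | U (x * a^-1)].
  move=> U1.
  have /Gpc[D Dfin DU] : nbhs 1 [set x : G | U x^-1].
    by apply: (@invg_continuous G 1); rewrite invg1.
  have [|a _ Fa] :=
      ultra_finite_cover F D (fun a => [set x | U (x * a)]) UF Dfin;
    last by exists a^-1; rewrite ?invgK.
    apply: filterS filterT => x _; have [a Da [u Uu ux]] := DU x^-1 I.
    by exists a => //=; rewrite -[x]invgK -ux invgM mulgVK.
have small n : exists E : set G, F E /\
    forall a b, E a -> E b -> B n (a^-1 * b) /\ B n (a * b^-1).
  have [V [oV V1 VV Vroot]] := nbhs1_root (B1 n).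
  have nV : nbhs 1 V by exact: open_nbhs_nbhs.
  have [a _ Fa] := left_small V nV; have [b _ Fb] := right_small V nV.
  exists ([set x | V (a^-1 * x)] `&` [set x | V (x * b^-1)]).
  split; first exact: filterI.
  move=> x y [/= ax bx] [/= ay yb].
  have := Vroot _ _ _ (VV _ ax) ay V1; have := Vroot _ _ _ bx (VV _ yb) V1.
  by rewrite !mulg1 !invgM !invgK -!mulgA !mulVKg mulKg.
have [E EP] := choice small.
have FE n : F (E n) by have [] := EP n.
have Esmall n a b : E n a -> E n b -> B n (a^-1 * b) /\ B n (a * b^-1).
  by have [_] := EP n; exact.
have Fall n : F [set x | forall i, (i <= n)%N -> E i x].
  elim: n => [|n IH].
    by apply: filterS (FE 0%N) => x Ex i; rewrite leqn0 => /eqP->.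
  apply: filterS (filterI IH (FE n.+1)) => x [xn xSn] i.
  by rewrite leq_eqVlt => /orP[/eqP->//|]; exact: xn.
have [x xE] := choice (fun n => filter_ex (Fall n)).
have xC : bicauchy x.
  move=> U /Bbasis[N NU]; exists N => m n Nm Nn.
  have [Emn _] := Esmall N _ _ (xE n N Nn) (xE m N Nm).
  have [_ Enm] := Esmall N _ _ (xE m N Nm) (xE n N Nn).
  by split; exact: NU.
have [p xp] := bicauchy_cvg Gcm xC.
exists p; split => // Q /nbhs_translate/nbhs1_root[V [oV V1 _ VQ]].
have nV : nbhs 1 V by exact: open_nbhs_nbhs.
have [n nV'] := Bbasis V nV.
have [K _ KV] : \forall m \near \oo, V (p^-1 * x m).
  by apply: (xp [set z | V (p^-1 * z)]); apply: nbhs_mulgl; rewrite mulVg.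
pose m := maxn K n.
apply: filterS (FE n) => a Ea.
have Vm : V (p^-1 * x m) by apply: KV; exact: leq_maxl.
have Va : V ((x m)^-1 * a).
  by apply: nV'; have [] := Esmall n _ _ (xE m n (leq_maxr _ _)) Ea.
by have := VQ _ _ _ Vm Va V1; rewrite /= mulg1 -mulgA !mulVKg.
Qed.

(** * Consequences of Roelcke precompactness *)

Section roelcke.
Context {G : topologicalGroupType} (roelckeG : roelcke_precompact G).
Implicit Types (x y z h k : G) (U V W F : set G).

Lemma roelcke_decomp V : open V -> V 1 -> exists2 F, finite_set F &
  forall x, exists u f v, [/\ V u, F f, V v & x = u * f * v].
Proof.
move=> oV V1; have [F Ffin GVFV] := roelckeG V oV V1; exists F => // x.
have : [set: G] x by [].
rewrite GVFV => -[_ [u Vu [f Ff <-]] [v Vv <-]].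
by exists u, f, v.
Qed.

(** Write [k^-1 h = w f v] with [w] and [v] small and [f] in a finite set.  Then
    [l = k w] works: conjugation by [w] and by [v] changes little, and the
    finitely many conjugations by [f] can be anticipated in the choice of
    [U]. *)
Lemma roelcke_conj2 W V : nbhs 1 W -> nbhs 1 V ->
  exists2 U, nbhs 1 U & forall k h, exists l, forall s,
    U (s ^ l) -> W (s ^ k) /\ V (s ^ h).
Proof.
move=> /nbhs1_root[W' [oW W1 WV Wroot]] /nbhs1_root[V' [oV V1 VV Vroot]].
have [|//|F Ffin decomp] := @roelcke_decomp (W' `&` V'); first exact: openI.
exists (W' `&` \bigcap_(f in F) [set s | V' (s ^ f)]).
  apply: filterI; first exact: open_nbhs_nbhs.
  by apply: filter_finite_bigcap => // f _; apply/nbhs_conjg/open_nbhs_nbhs.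
move=> k h; have [w [f [v [[Ww _] Ff [_ Vv] khE]]]] := decomp (k^-1 * h).
exists (k * w) => s [Ws Vs]; split.
  have := Wroot _ _ _ Ww Ws (WV _ Ww).
  by rewrite conjgM; move: (s ^ k) => t; rewrite conjgE !mulgA mulgV mul1g mulgK.
have -> : s ^ h = ((s ^ (k * w)) ^ f) ^ v.
  by rewrite -!conjgM -!mulgA (mulgA w) -khE mulVKg.
by rewrite conjgE mulgA; apply: Vroot => //; [exact: VV|exact: Vs].
Qed.

(** The points whose orbit under [W] is small at the scale [V] are, in the model
    case, the algebraic elements over a finite tuple, and the lemma says that
    there are finitely many of them in each sort.  The reason is the same: being
    such a point depends, up to a change of scale, only on the double coset of
    the point, and there are finitely many double cosets, each of which is small
    if it contains such a point. *)
Lemma roelcke_small_orbits W U : nbhs 1 W -> nbhs 1 U ->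
  exists V F, [/\ nbhs 1 V, finite_set F & forall x,
    (exists2 D, finite_set D & forall w, W w -> set_mulg D V (w * x)) ->
    set_mulg F U x].
Proof.
move=> /nbhs1_root[W' [oW W1 WV Wroot]] /nbhs1_root[V [oV V1 VV Vroot]].
pose V0 := W' `&` V.
have [||E Efin decomp] := @roelcke_decomp V0; [exact: openI|by []|].
have /choice[D DP] : forall e, exists D : set G, finite_set D /\
    ((exists2 F, finite_set F & forall w v, W' w -> V0 v ->
      set_mulg F U (w * e * v)) ->
    forall w v, W' w -> V0 v -> set_mulg D U (w * e * v)).
  move=> e; have [[F Ffin FP]|nF] := pselect (exists2 F, finite_set F &
    forall w v, W' w -> V0 v -> set_mulg F U (w * e * v)); first by exists F.
  by exists set0.
exists V, (\bigcup_(e in E) D e); split; first exact: open_nbhs_nbhs.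
  by apply: bigcup_finite => // e _; have [] := DP e.
move=> x [F Ffin FP]; have [w [e [v [V0w Ee V0v xE]]]] := decomp x.
have [_ De] := DP e.
have [|d Dd [u Uu dux]] := De _ w v (proj1 V0w) V0v; last first.
  by rewrite xE; exists d; [exists e|exists u].
exists F => // w1 v1 W'w1 [_ Vv1].
have /FP[d Fd [u Vu dux]] : W (w1 * w^-1).
  by rewrite -[_ * _]mulg1; apply: Wroot => //; apply: WV; case: V0w.
exists d => //; exists (u * v^-1 * v1).
  by apply: Vroot => //; apply: VV; case: V0v.
by rewrite !mulgA dux xE !mulgA mulgVK mulgK.
Qed.

Lemma separated_family U : (forall F, finite_set F -> ~ [set: G] `<=` set_mulg F U) ->
  forall m, exists g : nat -> G, forall i j, (i < j < m)%N -> ~ U ((g i)^-1 * g j).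
Proof.
move=> Uncov; elim=> [|m [g gP]]; first by exists (fun=> 1) => i j /andP[].
have /existsNP[x /existsNP[_ nx]] := Uncov (g @` `I_m) (finite_image _ (finite_II m)).
exists (fun i => if (i < m)%N then g i else x) => i j /andP[ij].
rewrite ltnS leq_eqVlt => /orP[/eqP jm|jm]; last first.
  by rewrite jm (ltn_trans ij jm); apply: gP; rewrite ij.
rewrite -jm ltnn ij => Ux; apply: nx.
exists (g i); first by exists i => //=; rewrite -jm.
by exists ((g i)^-1 * x) => //; rewrite mulVKg.
Qed.

(** If [W] is contained in [F V h], then [W h^-1 g] is contained in [F g U']
    for each [g] with [V g] contained in [g U'], so that [h^-1 g] has a small
    orbit.  The set [V] is chosen to make this apply to more points [g_i],
    pairwise [U]-separated, than there are translates of [U'] needed to cover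
    the points with a small orbit; two of the [h^-1 g_i] lie in one translate,
    which contradicts their separation. *)
Lemma nbhs_not_finitely_covered U W : nbhs 1 U ->
  (forall F, finite_set F -> ~ [set: G] `<=` set_mulg F U) ->
  nbhs 1 W -> exists2 V, nbhs 1 V & forall F h, finite_set F ->
    ~ W `<=` set_mulg (set_mulg F V) [set h].
Proof.
move=> /nbhs1_root[U' [oU U1 UV Uroot]] Uncov W1.
have U'1 : nbhs 1 U' by exact: open_nbhs_nbhs.
have [V0 [F [V01 /finite_seqP[s ->] FP]]] := roelcke_small_orbits W U' W1 U'1.
have [g gP] := separated_family U Uncov (size s).+1.
exists (\bigcap_(i in `I_(size s).+1) [set v | V0 (v ^ g i)]).
  by apply: filter_finite_bigcap => // i _; exact: nbhs_conjg.
move=> D h Dfin WDVh.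
have /choice[f fP] (i : nat) : exists f : G, (i < (size s).+1)%N ->
    f \in s /\ U' (f^-1 * (h^-1 * g i)).
  have [im|//] := boolP (i < (size s).+1)%N; last by exists 1.
  have [|f sf [u U'u fux]] := FP (h^-1 * g i).
    exists [set d * g i | d in D]; first exact: finite_image.
    move=> w /WDVh[_ [d Dd [v Vv <-]] [_ -> <-]].
    exists (d * g i); first by exists d.
    by exists (v ^ g i); [exact: Vv|rewrite conjgE !mulgA mulgK mulgK].
  by exists f => _; split => //; rewrite -fux mulKg.
have : (size (map f (iota 0 (size s).+1)) <= size s)%N.
  apply: uniq_leq_size.
  - rewrite map_inj_in_uniq ?iota_uniq// => i j.
    rewrite !mem_iota !add0n /= => im jm fij.
    have sep i' j' : (i' < j')%N -> (j' < (size s).+1)%N -> f i' = f j' -> False.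
      move=> ij jm' fE; have im' := ltn_trans ij jm'.
      have [_ Ui] := fP i' im'; have [_ Uj] := fP j' jm'.
      apply: (gP i' j'); first by rewrite ij.
      have := Uroot _ _ _ (UV _ Ui) Uj U1.
      by rewrite mulg1 fE !invgM !invgK -!mulgA !mulVKg.
    by have [ij|ij|//] := ltngtP i j; [case: (sep i j)|case: (sep j i)].
  - by move=> _ /mapP[i + ->]; rewrite mem_iota add0n => /fP[].
by rewrite size_map size_iota ltnn.
Qed.

End roelcke.

(** * Points outside a sequence of thin sets *)

(** A move in the construction of the limit point.  The current set is the
    translate by [x] of a conjugate of [W]; after [h] and [F] are revealed, it
    has a subset of the same form, with centre [y] and with [W'] in the place of
    [W], which is [O]-small to the left and to the right of [y] and whose points
    differ from [y] by elements of [h^-1 V h].  The point [y] is outside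
    [F V V V h] rather than only outside [F V h], so that the limit of later
    points is outside [F V h]. *)
Definition escapes {G : topologicalGroupType} (O W V W' : set G) :=
  forall x k h F, finite_set F -> exists y l,
    [/\ forall s, W' (s ^ l) ->
          [/\ W ((x^-1 * (y * s)) ^ k), O s, O (s ^ y^-1) & V (s ^ h^-1)]
      & forall a b c, V a -> V b -> V c ->
          ~ set_mulg F [set a * b * c] (y * h^-1)].

Lemma escape_step {G : topologicalGroupType} (roelckeG : roelcke_precompact G)
    (U O W V0 : set G) : nbhs 1 U ->
  (forall F, finite_set F -> ~ [set: G] `<=` set_mulg F U) ->
  nbhs 1 O -> nbhs 1 W -> nbhs 1 V0 ->
  exists V W', [/\ nbhs 1 V, (forall x, V x -> V x^-1), V `<=` O `&` V0,
    nbhs 1 W' & escapes O W V W'].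
Proof.
move=> U1 Uncov O1 W1 V01.
have [Wr [oWr Wr1 _ Wroot]] := nbhs1_root W1.
have nWr : nbhs 1 Wr by exact: open_nbhs_nbhs.
have [VA VA1 VAP] := nbhs_not_finitely_covered roelckeG U Wr U1 Uncov nWr.
have [V [oV V1 VV Vroot]] := nbhs1_root (filterI VA1 (filterI O1 V01)).
have nV : nbhs 1 V by exact: open_nbhs_nbhs.
have [W2 W21 W2P] := roelcke_conj2 roelckeG O V O1 nV.
have [W3 W31 W3P] := roelcke_conj2 roelckeG Wr O nWr O1.
have [W' W'1 W'P] := roelcke_conj2 roelckeG W2 W3 W21 W31.
exists V, W'; split => //.
  by move=> v Vv; have := Vroot _ _ _ Vv V1 V1; rewrite !mulg1 => -[_].
move=> x k h F Ffin.
(* The point sought is [y = x (k t k^-1)] with [t] in [Wr]; rewritten in terms of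
   [t], its membership in [F VA h] has the form that [VAP] excludes. *)
have [t Wrt nt] : exists2 t, Wr t &
    ~ set_mulg (set_mulg [set k^-1 * x^-1 * f | f in F] VA) [set h * k] t.
  apply: contrapT => nt; apply: (VAP [set k^-1 * x^-1 * f | f in F] (h * k)).
    exact: finite_image.
  by move=> t Wrt; apply: contrapT => ntt; apply: nt; exists t.
pose y := x * (k * t * k^-1).
(* The three later requirements and the one of remaining in the current set are
   membership of conjugates of [s] by [1], [h^-1], [k] and [y^-1]. *)
have [l2 l2P] := W2P 1 h^-1; have [l3 l3P] := W3P k y^-1.
have [l lP] := W'P l2 l3.
exists y, l; split.
  move=> s /lP[/l2P[Os Vs] /l3P[Ws Osy]]; rewrite conjg1 in Os; split => //.
  have := Wroot _ _ _ Wrt Ws Wr1.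
  by rewrite /y mulg1 !conjgE !mulgA mulgVK mulVg mul1g.
move=> a b c Va Vb Vc [f Ff [_ -> fabc]]; apply: nt.
exists (k^-1 * x^-1 * f * (a * b * c)).
  exists (k^-1 * x^-1 * f); first by exists f.
  by exists (a * b * c) => //; have [] := Vroot _ _ _ Va Vb Vc.
exists (h * k) => //.
by rewrite -(mulgA _ f) fabc /y !mulgA !mulgVK mulVg mul1g.
Qed.

Lemma escaping_point {R : realType} {G : topologicalGroupType}
    (B W V : nat -> set G) (h : nat -> G) (F : nat -> set G) :
  completely_metrizable R G -> nbhs_basis 1 B ->
  (forall n, nbhs 1 (W n)) -> (forall n, nbhs 1 (V n)) ->
  (forall n x, V n x -> V n x^-1) ->
  (forall n, escapes (B n) (W n) (V n) (W n.+1)) ->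
  (forall n, finite_set (F n)) ->
  exists p, forall n, ~ set_mulg (set_mulg (F n) (V n)) [set h n] p.
Proof.
move=> Gcm [_ Bbasis] W1 V1 VV esc Ffin.
have [||g gP] := @indexed_dependent_choice (G * G) (fun _ _ => True)
  (fun n s s' => [/\ forall t, W n.+1 (t ^ s'.2) ->
      [/\ W n ((s.1^-1 * (s'.1 * t)) ^ s.2), B n t, B n (t ^ s'.1^-1)
        & V n (t ^ (h n)^-1)]
    & forall a b c, V n a -> V n b -> V n c ->
        ~ set_mulg (F n) [set a * b * c] (s'.1 * (h n)^-1)]) (1, 1) => //.
  move=> n [x k] _; have [y [l yl]] := esc n x k (h n) (F n) (Ffin n).
  by exists (y, l).
pose x n := (g n).1; pose k n := (g n).2.
pose C n := [set z | W n (((x n)^-1 * z) ^ k n)].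
have Cstep n z : C n.+1 z -> [/\ C n z, B n ((x n.+1)^-1 * z),
    B n (z * (x n.+1)^-1) & V n (((x n.+1)^-1 * z) ^ (h n)^-1)].
  move=> /= Cz; have [_ [/(_ _ Cz) + _]] := gP n.
  have -> : ((x n.+1)^-1 * z) ^ (x n.+1)^-1 = z * (x n.+1)^-1.
    by rewrite conjgE invgK mulgA mulVKg.
  by rewrite mulVKg.
have Cx m n : (n <= m)%N -> C n (x m).
  move=> /subnKC <-; move: (m - n)%N => j; elim: j n => [|j IH] n; last first.
    by rewrite addnS -addSn; have [] := Cstep _ _ (IH n.+1).
  by rewrite addn0 /C /= mulVg conj1g; exact: nbhs_singleton.
have xC : bicauchy x.
  move=> U /nbhs1_root[A [oA A1 AV Aroot]].
  have [n nA] := Bbasis A (open_nbhs_nbhs (conj oA A1)).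
  exists n.+1 => i j ni nj.
  have [_ /nA il /nA ir _] := Cstep n _ (Cx i n.+1 ni).
  have [_ /nA jl /nA jr _] := Cstep n _ (Cx j n.+1 nj).
  have := Aroot _ _ _ (AV _ jl) il A1; have := Aroot _ _ _ ir (AV _ jr) A1.
  by rewrite !mulg1 !invgM !invgK !mulgA mulgK mulgVK.
have [p xp] := bicauchy_cvg Gcm xC.
exists p => n [_ [f Ff [v Vv <-]] [_ -> fvp]].
have [K _ KV] : \forall m \near \oo, V n ((p^-1 * x m) ^ (h n)^-1).
  apply: (xp [set z | V n ((p^-1 * z) ^ (h n)^-1)]).
  apply: (nbhs_mulgl (x := p^-1) (U := [set s | V n (s ^ (h n)^-1)])).
  by rewrite mulVg; exact: nbhs_conjg.
pose m := maxn K n.+1.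
have [_ _ _ Vy] := Cstep n _ (Cx m n.+1 (leq_maxr _ _)).
have Vp : V n ((p^-1 * x m) ^ (h n)^-1) by apply: KV; exact: leq_maxl.
(* Both [x n.+1] and [p] are close to [x m], whence [x n.+1] is in [F V V V h] if
   [p] is in [F V h]. *)
have [_ [_ /(_ _ _ _ Vv Vp (VV _ _ Vy))]] := gP n; apply.
exists f => //; eexists; first by [].
by rewrite !conjgE !invgM !invgK !mulgA fvp mulgV mul1g mulgVK mulgV mul1g.
Qed.

Theorem theorem1p7 (R : realType) (G : topologicalGroupType)
    (polishG : polish R G) (noncompactG : ~ compact [set: G])
    (roelckeG : roelcke_precompact G) :
  exists V : nat -> set G,
    [/\ nbhs_basis 1 V,
        forall n, V n.+1 `<=` V n
      & forall (h : nat -> G) (F : nat -> set G),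
          (forall n, finite_set (F n)) ->
          [set: G] <> \bigcup_n set_mulg (set_mulg (F n) (V n)) [set h n]].
Proof.
have [_ Gcm] := polishG.
have [U U1 Uncov] : exists2 U : set G, nbhs 1 U &
    forall F, finite_set F -> ~ [set: G] `<=` set_mulg F U.
  apply: contrapT => nU; apply: noncompactG; apply: compact_of_precompact Gcm _.
  move=> U U1; apply: contrapT => nF; apply: nU; exists U => // F Ffin FU.
  by apply: nF; exists F.
have [B Bbasis] := metrizable_nbhs_basis (1 : G) Gcm.
(* The [n]-th state is [(W_n, V_(n-1))] with [V_(-1) = G], because [V_n] and
   [W_(n+1)] are obtained together from [W_n]. *)
have [||f fP] := @indexed_dependent_choice (set G * set G)
  (fun _ s => nbhs 1 s.1 /\ nbhs 1 s.2)
  (fun n s s' => [/\ forall x, s'.2 x -> s'.2 x^-1, s'.2 `<=` B n `&` s.2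
    & escapes (B n) s.1 s'.2 s'.1]) (setT, setT).
- by split; exact: filterT.
- move=> n [W V0] /= [W1 V01].
  have [V [W' [V1 VV VB W'1 esc]]] :=
    escape_step roelckeG U (B n) W V0 U1 Uncov (proj1 Bbasis n) W1 V01.
  by exists (W', V).
exists (fun n => (f n.+1).2); split.
- split=> [n|A /(proj2 Bbasis)[n nA]]; first by have [[]] := fP n.+1.
  by exists n => x; have [_ [_ VB _]] := fP n; move=> /VB[/nA].
- by move=> n x; have [_ [_ VB _]] := fP n.+1; move=> /VB[].
- move=> h F Ffin cover.
  have [|||||p pP] := escaping_point B (fun n => (f n).1) (fun n => (f n.+1).2) h F
    Gcm Bbasis.
  + by move=> n; have [[]] := fP n.
  + by move=> n; have [[]] := fP n.+1.
  + by move=> n; have [_ []] := fP n.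
  + by move=> n; have [_ []] := fP n.
  + by [].
  + have : [set: G] p by [].
    by rewrite cover => -[n _ /pP].
Qed.
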